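(* Let $\mathcal{A}\in\mathbb{R}^{n_1\times n_2\times n_3}$ be a partially given tensor whose entries $\mathcal{A}_{ijk}$ are given exactly for $(i,j,k)\in\Omega$, where $\Omega\subseteq[n_1]\times[n_2]\times[n_3]$ is nonempty, let $\Omega_k=\{(i,j,k')\in\Omega: k'=k\}$ for $k=1,\ldots,n_3$, and let $(\hat i,\hat j,\hat k)\in\Omega$ be an index with $|\mathcal{A}_{\hat i\hat j\hat k}|=\max_{(i,j,k)\in\Omega}|\mathcal{A}_{ijk}|$. Consider the matrix recovery problem: (MR) find $X=ab^T\in\mathbb{R}^{n_1\times n_2}$ (with $a\in\mathbb{R}^{n_1}$, $b\in\mathbb{R}^{n_2}$) such that $X_{\hat i\hat j}=1$ and $$\mathcal{A}_{i j k}X_{i' j'}-\mathcal{A}_{i' j' k}X_{i j}=0\quad\text{for all } (i,j,k),(i',j',k)\in\Omega_k,\ k=1,\ldots,n_3.$$ Suppose $X=ab^T$ is feasible for (MR) and that for each $k=1,\ldots,n_3$ the system of equations in the single unknown $c_k\in\mathbb{R}$ $$\mathcal{A}_{ijk}=a_ib_j\,c_k\qquad\text{for all }(i,j,k)\in\Omega_k$$ has a nonzero coefficient vector, i.e. $(a_ib_j)_{(i,j,k)\in\Omega_k}\neq 0$. Then $\mathcal{A}$ has the rank-$1$ completion $\mathcal{A}=a\otimes b\otimes c$ with $c=(c_1,\ldots,c_{n_3})$, where each $c_k$ is a solution of the system $\mathcal{A}_{ijk}=a_ib_j\,c_k$ for all $(i,j,k)\in\Omega_k$. Conversely, if $\mathcal{A}$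 is rank-$1$ completable and $\mathcal{A}_{\hat i\hat j\hat k}\neq 0$, then (MR) has a rank-$1$ feasible matrix solution $X=ab^T$.
   Context: $[n]=\{1,\ldots,n\}$. A partially given tensor $\mathcal{A}\in\mathbb{R}^{n_1\times n_2\times n_3}$ with index set $\Omega$ is a family of real numbers $(\mathcal{A}_{ijk})_{(i,j,k)\in\Omega}$. A rank-$1$ completion of $\mathcal{A}$, written $\mathcal{A}=a\otimes b\otimes c$, is a triple $(a,b,c)\in\mathbb{R}^{n_1}\times\mathbb{R}^{n_2}\times\mathbb{R}^{n_3}$ with $a_ib_jc_k=\mathcal{A}_{ijk}$ for all $(i,j,k)\in\Omega$; $\mathcal{A}$ is rank-$1$ completable if such a triple exists. *)

(* Defs.v *)
From mathcomp Require Export all_boot all_order all_algebra.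
From mathcomp Require Export reals.

Set Implicit Arguments.
Unset Strict Implicit.
Unset Printing Implicit Defensive.

Import Order.TTheory GRing.Theory Num.Theory.
Local Open Scope ring_scope.

Section PartialTensor.

Variables (R : realType) (n1 n2 n3 : nat).

(* The elements of Omega, as a type: a partial tensor has no values at all
   outside Omega. Indices are 0-based ('I_n stands for [n] = {1, ..., n}). *)
Definition given (Omega : {set 'I_n1 * 'I_n2 * 'I_n3}) : finType :=
  {x : 'I_n1 * 'I_n2 * 'I_n3 | x \in Omega}.

Definition ptensor (Omega : {set 'I_n1 * 'I_n2 * 'I_n3}) : Type :=
  given Omega -> R.

Variable Omega : {set 'I_n1 * 'I_n2 * 'I_n3}.

Definition idx1 (t : given Omega) : 'I_n1 := (val t).1.1.
Definition idx2 (t : given Omega) : 'I_n2 := (val t).1.2.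
Definition idx3 (t : given Omega) : 'I_n3 := (val t).2.

Definition slice (k : 'I_n3) : {set given Omega} :=
  [set t : given Omega | idx3 t == k].

Variable A : ptensor Omega.

Definition rank1_completion
    (a : 'cV[R]_n1) (b : 'cV[R]_n2) (c : 'cV[R]_n3) : Prop :=
  forall t : given Omega, a (idx1 t) 0 * b (idx2 t) 0 * c (idx3 t) 0 = A t.

Definition rank1_completable : Prop :=
  exists (a : 'cV[R]_n1) (b : 'cV[R]_n2) (c : 'cV[R]_n3),
    rank1_completion a b c.

Definition max_entry (h : given Omega) : Prop :=
  forall t : given Omega, `|A t| <= `|A h|.

Definition MR_feasible (h : given Omega) (X : 'M[R]_(n1, n2)) : Prop :=
  [/\ exists (a : 'cV[R]_n1) (b : 'cV[R]_n2), X = a *m b^T,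
      X (idx1 h) (idx2 h) = 1
    & forall (k : 'I_n3) (t t' : given Omega),
        t \in slice k -> t' \in slice k ->
        A t * X (idx1 t') (idx2 t') - A t' * X (idx1 t) (idx2 t) = 0].

Definition coef_vector (a : 'cV[R]_n1) (b : 'cV[R]_n2) (k : 'I_n3) :
    {ffun {t : given Omega | t \in slice k} -> R} :=
  [ffun t => a (idx1 (val t)) 0 * b (idx2 (val t)) 0].

Definition solves_slice
    (a : 'cV[R]_n1) (b : 'cV[R]_n2) (k : 'I_n3) (ck : R) : Prop :=
  forall t : given Omega, t \in slice k ->
    A t = a (idx1 t) 0 * b (idx2 t) 0 * ck.

End PartialTensor.

Arguments coef_vector {R n1 n2 n3} Omega a b k.

(* Main.v *)
Require Import Defs.
From mathcomp Require Import all_boot all_order all_algebra.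
From mathcomp Require Import reals ring.

Import Order.TTheory GRing.Theory Num.Theory.
Local Open Scope ring_scope.

(** The equations of the matrix problem say that, on each slice [k], the data
    vector [(A t)] and the coefficient vector [(a_i b_j)] have vanishing
    2x2 minors, i.e. are linearly dependent.  If the coefficient vector is
    nonzero, dependence makes the data vector a multiple of it, and the factor
    is the wanted [c_k]; a completion is nothing but a solution of all the slice
    systems at once, so these factors form a completion
    ([slice_solvable], [rank1_completion_of_slices]).

    Conversely, the slices of a completion [a (x) b (x) c] are all multiples of
    the matrix [a b^T], so their minors against [a b^T] vanish, and this
    persists when [a] is rescaled.  As the reference entry
    [A h = a_i b_j c_k] is nonzero, so is [a_i b_j], and dividing [a] by it
    normalises the reference entry of [a b^T] to 1
    ([completion_MR_feasible]). *)

Lemma outerE (R : realType) (m n : nat) (a : 'cV[R]_m) (b : 'cV[R]_n) i j :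
  (a *m b^T) i j = a i 0 * b j 0.
Proof. by rewrite mxE big_ord1 mxE. Qed.

Lemma outer_rank1 (R : realType) (m n : nat) (a : 'cV[R]_m) (b : 'cV[R]_n) :
  a *m b^T != 0 -> \rank (a *m b^T) = 1%N.
Proof.
move=> ab_neq0; apply/eqP; rewrite eqn_leq lt0n mxrank_eq0 ab_neq0 andbT.
exact: leq_trans (mxrankM_maxl _ _) (rank_leq_col _).
Qed.

Section PartialTensor.

Set Implicit Arguments.
Unset Strict Implicit.

Variables (R : realType) (n1 n2 n3 : nat).
Variables (Omega : {set 'I_n1 * 'I_n2 * 'I_n3}) (A : ptensor R Omega).
Implicit Types (a : 'cV[R]_n1) (b : 'cV[R]_n2) (c : 'cV[R]_n3).

(** A position [t] of the slice with nonzero coefficient determines the factor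
    [A t / (a_i b_j)]; the minor of [t] against any other position of the slice
    says that this factor is right there too. *)
Lemma slice_solvable (h : given Omega) a b k :
  MR_feasible A h (a *m b^T) -> coef_vector Omega a b k != 0 ->
  exists ck, solves_slice A a b k ck.
Proof.
case=> _ _ minors0 coef_neq0.
case: (pickP (fun t => coef_vector Omega a b k t != 0)) => [t t_neq0 | coef0].
  exists (A (val t) / coef_vector Omega a b k t) => t' t'k.
  move: t_neq0; rewrite ffunE => t_neq0.
  have := minors0 k _ _ (valP t) t'k; rewrite !outerE => /subr0_eq minor.
  by rewrite mulrA [_ * A _]mulrC minor mulfK.
case/eqP: coef_neq0; apply/ffunP => t.
by move/negbFE/eqP: (coef0 t) => ->; rewrite ffunE.
Qed.

Lemma rank1_completion_of_slices a b c :
  (forall k, solves_slice A a b k (c k 0)) -> rank1_completion A a b c.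
Proof. by move=> solves t; rewrite (solves (idx3 t)) // inE. Qed.

Lemma completion_MR_feasible (h : given Omega) a b c :
  rank1_completion A a b c -> A h != 0 ->
  MR_feasible A h (((a (idx1 h) 0 * b (idx2 h) 0)^-1 *: a) *m b^T).
Proof.
move=> Aabc; rewrite -Aabc mulf_eq0 negb_or => /andP[ab_neq0 _].
split; first by eexists; eexists.
  by rewrite outerE mxE -mulrA mulVf.
move=> k t t'; rewrite !inE => /eqP tk /eqP t'k.
rewrite -!Aabc tk t'k !outerE !mxE; apply/eqP; rewrite subr_eq0; apply/eqP.
ring.
Qed.

End PartialTensor.

Theorem theorem3p1 (R : realType) (n1 n2 n3 : nat)
    (Omega : {set 'I_n1 * 'I_n2 * 'I_n3}) (Omega_neq0 : Omega != set0)
    (A : ptensor R Omega) (h : given Omega) (h_max : max_entry A h) :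
  (forall (a : 'cV[R]_n1) (b : 'cV[R]_n2),
     MR_feasible A h (a *m b^T) ->
     (forall k : 'I_n3, coef_vector Omega a b k != 0) ->
     exists c : 'cV[R]_n3,
       (forall k : 'I_n3, solves_slice A a b k (c k 0)) /\
       rank1_completion A a b c)
  /\
  (rank1_completable A -> A h != 0 ->
   exists (a : 'cV[R]_n1) (b : 'cV[R]_n2),
     \rank (a *m b^T) = 1%N /\ MR_feasible A h (a *m b^T)).
Proof.
split=> [a b feas coef_neq0 | [a [b [c Aabc]]] Ah_neq0].
  have /fin_all_exists[c c_solves] k := slice_solvable feas (coef_neq0 k).
  have solves k : solves_slice A a b k ((\col_i c i) k 0) by rewrite mxE.
  by exists (\col_i c i); split=> //; apply: rank1_completion_of_slices.
have feas := completion_MR_feasible Aabc Ah_neq0.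
exists ((a (idx1 h) 0 * b (idx2 h) 0)^-1 *: a), b; split=> //.
(* the entry normalised to 1 keeps the product nonzero *)
apply: outer_rank1; apply/eqP => X0.
by case: feas => _ /eqP; rewrite X0 mxE eq_sym oner_eq0.
Qed.
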